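(* There exist infinitely many triples $\{a,b,c\}$ of distinct nonzero rational numbers such that each of the seven numbers \[ a+1,\quad b+1,\quad c+1,\quad ab+1,\quad ac+1,\quad bc+1,\quad abc+1 \] is the square of a rational number.
   Context: A rational number is called a perfect square if it is the square of a rational number. *)

(* Defs.v *)
From HB Require Import structures.
From mathcomp Require Import all_boot all_order all_algebra.
From mathcomp Require Import finmap.
From mathcomp Require Import boolp classical_sets cardinality.

Set Implicit Arguments.
Unset Strict Implicit.
Unset Printing Implicit Defensive.

Import GRing.Theory.
Local Open Scope ring_scope.

Definition perfect_square (x : rat) : Prop := exists q : rat, x = q ^+ 2.

Definition square_triple (a b c : rat) : Prop :=
  [/\ [/\ a != b, a != c & b != c],
      [/\ a != 0, b != 0 & c != 0],
      [/\ perfect_square (a + 1), perfect_square (b + 1)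
        & perfect_square (c + 1)],
      [/\ perfect_square (a * b + 1), perfect_square (a * c + 1)
        & perfect_square (b * c + 1)]
    & perfect_square (a * b * c + 1)].

(* Main.v *)
Require Import Defs.
From HB Require Import structures.
From mathcomp Require Import all_boot all_order all_algebra.
From mathcomp Require Import finmap.
From mathcomp Require Import boolp classical_sets cardinality.
From mathcomp Require Import zify ring.

Set Implicit Arguments.
Unset Strict Implicit.
Unset Printing Implicit Defensive.

Import GRing.Theory.
Local Open Scope ring_scope.
Local Open Scope classical_set_scope.

(** Look for regular quadruples {1, a, b, c}: with a + 1 = x^2, b + 1 = y^2 and
    c + 1 = t^2, the relation x^2 + y^2 + t^2 = 2 + 2 x y t makes ab + 1,
    ac + 1 and bc + 1 the squares of xy - t, xt - y and yt - x.  If moreover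
    xy - t = t - 1, then {1, c, ab} is a regular triple, so abc + 1 is a square
    as well.  Eliminating t leaves the genus one curve
      3 x^2 y^2 + 2 x y + 7 = 4 x^2 + 4 y^2,
    which is isomorphic to the elliptic curve H^2 = K^3 + 18 K^2 - 3 K.  In the
    coordinates k = 1/K, e = H/K^2 around the point at infinity, each doubling
    raises the 2-adic valuation of e by one, starting from (k, e) = (4, 10);
    the valuations of a, b, c along this sequence are n + 4, 3 and 0. *)

(** * Identities leading from the elliptic curve to triples *)

Section Parametrization.
Variable F : numFieldType.
Implicit Types k e t u v x y : F.

Definition curve k e := e ^+ 2 = k + 18 * k ^+ 2 - 3 * k ^+ 3.

(** Doubling for the group law: [K] becomes [(K^2 + 3)^2 / (4 H^2)], rewritten in [k = 1/K]. *)
Lemma curve_double k e (d := 1 + 3 * k ^+ 2) : d != 0 -> curve k e ->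
  curve (4 * e ^+ 2 / d ^+ 2)
    (2 * e * (1 + 36 * k - 18 * k ^+ 2 - 108 * k ^+ 3 + 9 * k ^+ 4) / d ^+ 3).
Proof.
rewrite /curve => d0 E; set f := 1 + 36 * k - _ - _ + _.
have -> : (2 * e * f / d ^+ 3) ^+ 2 = 4 * e ^+ 2 * f ^+ 2 / d ^+ 6 by field.
by rewrite E /f; move: d0; rewrite /d => d0; field.
Qed.

(** The coordinate [x - 1]; the point at infinity [k = e = 0] goes to [x = 1], [v = -1] on the
    quartic. *)
Definition xshift k e := 2 * (e + 3 * k * (k - 1)) / (1 + 6 * k - 3 * k ^+ 2).

(** On the curve this is [1 - 3 u + g u^2] with [u = xshift k e] and [g = -(1 + 3 k) / (2 k)], put
    in a form where the factor [k] of the denominator has cancelled. *)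
Definition vcoord k e :=
  1 - 3 * xshift k e - 2 * (1 + 3 * k) *
    (1 + 18 * k - 3 * k ^+ 2 + 6 * (k - 1) * e + 9 * k * (k - 1) ^+ 2)
    / (1 + 6 * k - 3 * k ^+ 2) ^+ 2.

Lemma curve_quartic k e :
  k != 0 -> 1 + 6 * k - 3 * k ^+ 2 != 0 -> curve k e ->
  vcoord k e ^+ 2 = 3 * (1 + xshift k e) ^+ 4 - 9 * (1 + xshift k e) ^+ 2 + 7.
Proof.
move=> k0 Q0 E; rewrite /vcoord; set u := xshift k e; set M := (X in _ * X / _).
(* With v = 1 - 3 u + g u^2 the quartic v^2 = (1 - 3 u)^2 + 3 u^3 (u + 4)
   becomes quadratic in u, with a square discriminant on the curve. *)
pose g := - (1 + 3 * k) / (2 * k).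
have -> : 2 * (1 + 3 * k) * M / (1 + 6 * k - 3 * k ^+ 2) ^+ 2 = - (g * u ^+ 2).
  have -> : u ^+ 2 = 4 * k * M / (1 + 6 * k - 3 * k ^+ 2) ^+ 2.
    have -> : 4 * k * M = 4 * (k + 18 * k ^+ 2 - 3 * k ^+ 3
        + 6 * k * (k - 1) * e + 9 * k ^+ 2 * (k - 1) ^+ 2) by rewrite /M; ring.
    by rewrite -E /u /xshift; field.
  by rewrite /g; field; rewrite Q0.
have uE : u ^+ 2 * (g ^+ 2 - 3) - u * (6 * g + 12) + 2 * g = 0.
  transitivity ((e ^+ 2 - (k + 18 * k ^+ 2 - 3 * k ^+ 3))
    / (k ^+ 2 * (1 + 6 * k - 3 * k ^+ 2))); last by rewrite E subrr mul0r.
  by rewrite /u /xshift /g; field; rewrite Q0.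
rewrite opprK; apply/eqP; rewrite -subr_eq0; apply/eqP.
transitivity (u ^+ 2 * (u ^+ 2 * (g ^+ 2 - 3) - u * (6 * g + 12) + 2 * g)).
  by ring.
by rewrite uE mulr0.
Qed.

(** As a quadratic in [y], the relation has discriminant [16 v^2]; the given [y] is one of its
    roots. *)
Lemma quartic_biquadratic x v (y := (2 * v - x) / (3 * x ^+ 2 - 4)) :
  3 * x ^+ 2 - 4 != 0 -> v ^+ 2 = 3 * x ^+ 4 - 9 * x ^+ 2 + 7 ->
  3 * x ^+ 2 * y ^+ 2 + 2 * x * y + 7 = 4 * x ^+ 2 + 4 * y ^+ 2.
Proof.
move=> d0 E; apply/eqP; rewrite -subr_eq0; apply/eqP.
transitivity (4 * (v ^+ 2 - (3 * x ^+ 4 - 9 * x ^+ 2 + 7)) / (3 * x ^+ 2 - 4)).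
  by rewrite /y; field.
by rewrite E subrr mulr0 mul0r.
Qed.

Lemma biquadratic_squares x y t : 2 * t = 1 + x * y ->
  3 * x ^+ 2 * y ^+ 2 + 2 * x * y + 7 = 4 * x ^+ 2 + 4 * y ^+ 2 ->
  [/\ (x ^+ 2 - 1) * (y ^+ 2 - 1) + 1 = (1 - t) ^+ 2,
      (x ^+ 2 - 1) * (t ^+ 2 - 1) + 1 = (x * t - y) ^+ 2,
      (y ^+ 2 - 1) * (t ^+ 2 - 1) + 1 = (y * t - x) ^+ 2 &
      (x ^+ 2 - 1) * (y ^+ 2 - 1) * (t ^+ 2 - 1) + 1 = (t ^+ 2 - t - 1) ^+ 2].
Proof.
move=> t2 E.
have tE : t = (1 + x * y) / 2 by rewrite -t2; field.
have regE : x ^+ 2 + y ^+ 2 = 2 - t ^+ 2 + 2 * x * y * t.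
  have -> : x ^+ 2 + y ^+ 2 = (4 * x ^+ 2 + 4 * y ^+ 2) / 4 by field.
  by rewrite -E tE; field.
(* This turns [ab + 1] and [abc + 1] into polynomials in [t] alone, both perfect squares. *)
have abE : (x ^+ 2 - 1) * (y ^+ 2 - 1) = t ^+ 2 - 2 * t.
  transitivity ((x * y) ^+ 2 - (x ^+ 2 + y ^+ 2) + 1); first by ring.
  by rewrite regE tE; field.
have reg0 : 2 - t ^+ 2 + 2 * x * y * t - (x ^+ 2 + y ^+ 2) = 0.
  by rewrite regE subrr.
rewrite abE; split; try by ring.
- by apply/eqP; rewrite -subr_eq0 -reg0; apply/eqP; ring.
- by apply/eqP; rewrite -subr_eq0 -reg0; apply/eqP; ring.
Qed.

End Parametrization.

(** * The ring of rationals with odd denominator, its units, and 2-adic valuations *)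

Definition int2_pred (x : rat) := odd `|denq x|.
Definition int2 := [qualify a x | int2_pred x].

(** The reduced denominator divides [q], hence is odd. *)
Lemma int2_div (p q : int) : odd `|q| -> p%:Q / q%:Q \is a int2.
Proof.
move=> oq; have q0 : q != 0 by apply: contraL oq => /eqP ->.
set x := _ / _.
have xE : numq x * q = p * denq x.
  apply: (@intr_inj rat); rewrite !intrM numqE /x.
  by field; rewrite intr_eq0.
have dq : (`|denq x| %| `|q|)%N.
  rewrite -(@Gauss_dvdr _ `|numq x|) -?abszM ?xE ?abszM ?dvdn_mull //.
  by rewrite coprime_sym coprime_num_den.
exact: dvdn_odd dq oq.
Qed.

Lemma int2P x : x \is a int2 -> exists p q : int, odd `|q| /\ x = p%:Q / q%:Q.
Proof. by move=> ox; exists (numq x), (denq x); rewrite divq_num_den. Qed.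

Lemma intr_odd_neq0 (q : int) : odd `|q| -> q%:Q != 0.
Proof. by move=> oq; rewrite intr_eq0; apply: contraL oq => /eqP ->. Qed.

Lemma int2_subring : subring_closed int2.
Proof.
split=> [|x y|x y]; first by [].
- move=> /int2P[p [q [oq ->]]] /int2P[r [s [os ->]]].
  have -> : p%:Q / q%:Q - r%:Q / s%:Q = (p * s - r * q)%:Q / (q * s)%:Q.
    by rewrite !(intrM, intrD, rmorphN) /=; field; rewrite !intr_odd_neq0.
  by apply: int2_div; rewrite abszM oddM oq.
- move=> /int2P[p [q [oq ->]]] /int2P[r [s [os ->]]].
  have -> : p%:Q / q%:Q * (r%:Q / s%:Q) = (p * r)%:Q / (q * s)%:Q.
    by rewrite !intrM; field; rewrite !intr_odd_neq0.
  by apply: int2_div; rewrite abszM oddM oq.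
Qed.

HB.instance Definition _ :=
  GRing.isSubringClosed.Build rat int2_pred int2_subring.

(** The units of the localization of the integers at 2. *)
Definition odd2 (x : rat) := exists2 z, z \is a int2 & x = 1 + 2 * z.

(* The cases are selected by syntax: unification would evaluate numerals. *)
Ltac int2 := lazymatch goal with |- is_true (in_mem ?x _) =>
  lazymatch x with
  | _ + _ => apply: rpredD; int2
  | - _ => rewrite rpredN; int2
  | _ * _ => apply: rpredM; int2
  | _ ^+ _ => apply: rpredX; int2
  | _%:R => apply: rpred_nat
  | 1 => apply: rpred1
  | _ => assumption
  end end.

Lemma odd2_int2 x : odd2 x -> x \is a int2.
Proof. by case=> z iz ->; int2. Qed.

(** Source of the contradictions below: a unit that is 0 or even would put [1/2] in [int2]. *)
Lemma half_notin_int2 : 2^-1 \isn't a int2.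
Proof. by []. Qed.

Lemma odd2_neq0 x : odd2 x -> x != 0.
Proof.
case=> z iz ->; apply: contraNneq half_notin_int2 => z0.
have -> : 2^-1 = - z.
  by apply: (@mulfI _ 2) => //; rewrite mulrN -(addKr 1 (2 * z)) z0; field.
by int2.
Qed.

Lemma odd2M x y : odd2 x -> odd2 y -> odd2 (x * y).
Proof.
move=> [z iz ->] [w iw ->]; exists (z + w + 2 * z * w); last by ring.
by int2.
Qed.

Lemma odd2V x : odd2 x -> odd2 x^-1.
Proof.
move=> ox; have x0 := odd2_neq0 ox; case: (ox) => z iz xE.
(* Since [x^-1 = 1 - 2 z x^-1], integrality of the inverse suffices. *)
suff ixV : x^-1 \is a int2.
  by exists (- z * x^-1); [int2 | rewrite xE; field; rewrite -xE].
case/int2P: iz => p [q [oq zE]].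
have rE : x = (q + 2 * p)%:Q / q%:Q.
  rewrite xE zE intrD intrM; field; exact: intr_odd_neq0.
by rewrite rE invf_div; apply: int2_div; lia.
Qed.

Lemma odd2_exp_inj m n x y :
  odd2 x -> odd2 y -> 2 ^+ m * x = 2 ^+ n * y -> m = n.
Proof.
wlog lt_mn : m n x y / (m < n)%N.
  move=> wl ox oy E; case: (ltngtP m n) => // h; first exact: wl E.
  by apply/esym; apply: (wl n m y x).
move=> [z iz ->] oy; rewrite -(subnKC (ltnW lt_mn)) exprD -mulrA.
have two0 : 2 ^+ m != 0 :> rat by rewrite expf_neq0.
move/(mulfI two0) => E; exfalso; have iy := odd2_int2 oy.
have /negP := half_notin_int2; apply.
have -> : 2^-1 = 2 ^+ (n - m).-1 * y - z :> rat.
  apply: (@mulfI _ 2) => //; rewrite mulrBr mulrA -exprS prednK ?subn_gt0 // -E.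
  by field.
by int2.
Qed.

Definition val2 (n : nat) (x : rat) := exists2 w, odd2 w & x = 2 ^+ n * w.

Lemma val2_neq0 n x : val2 n x -> x != 0.
Proof. by case=> w ow ->; rewrite mulf_neq0 ?expf_neq0 ?(odd2_neq0 ow). Qed.

Lemma val2_inj m n x : val2 m x -> val2 n x -> m = n.
Proof. by move=> [w ow ->] [w' ow']; apply: odd2_exp_inj. Qed.

Lemma val2_neq m n x y : m != n -> val2 m x -> val2 n y -> x != y.
Proof.
move=> mn vx vy; apply: contraNneq mn => xy.
by rewrite xy in vx; rewrite (val2_inj vx vy).
Qed.

(** * Valuations along the doubling sequence and of the resulting triples *)

(** Evenness of [k] makes [1 + 3 k^2] and the degree 4 factor of the doubling formula odd, so [e]
    gains exactly one factor 2. *)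
Lemma curve_val2 n : exists k e : rat,
  [/\ curve k e, exists2 k', k' \is a int2 & k = 2 * k' & val2 n.+1 e].
Proof.
elim: n => [|n [k [e [E [k' ik kE] [w ow eE]]]]].
  exists 4, 10; split=> //; first by exists 2.
  by exists 5 => //; exists 2.
have od : odd2 (1 + 3 * k ^+ 2).
  by exists (6 * k' ^+ 2); [int2 | rewrite kE; ring].
have iV := odd2_int2 (odd2V od); have iw := odd2_int2 ow.
have := curve_double (odd2_neq0 od) E.
set k2 := (X in curve X _); set e2 := (X in curve _ X).
move=> E2; exists k2, e2; split=> //.
  exists (2 * e ^+ 2 * (1 + 3 * k ^+ 2)^-1 ^+ 2).
    by rewrite eE; int2.
  by rewrite /k2 -exprVn; ring.
exists (w * (1 + 36 * k - 18 * k ^+ 2 - 108 * k ^+ 3 + 9 * k ^+ 4)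
    * ((1 + 3 * k ^+ 2)^-1 * ((1 + 3 * k ^+ 2)^-1 * (1 + 3 * k ^+ 2)^-1))).
  apply: odd2M; last by do !apply: odd2M; apply: odd2V.
  apply: odd2M => //.
  exists (36 * k' - 36 * k' ^+ 2 - 432 * k' ^+ 3 + 72 * k' ^+ 4).
    by int2.
  by rewrite kE; ring.
by rewrite /e2 eE [2 ^+ n.+2]exprS -exprVn; ring.
Qed.

(** Modulo 8, [x = 1] and [v = -1] force [y = 3], so [y^2 - 1] is 8 times a unit; then
    [(1 + x y) / 2] is even and its square minus 1 is a unit. *)
Lemma biquadratic_val2 x y v u1 v1 :
  u1 \is a int2 -> v1 \is a int2 -> x = 1 + 8 * u1 -> v = -1 + 8 * v1 ->
  y = (2 * v - x) / (3 * x ^+ 2 - 4) ->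
  [/\ 3 * x ^+ 2 - 4 != 0, val2 3 (y ^+ 2 - 1)
    & val2 0 (((1 + x * y) / 2) ^+ 2 - 1)].
Proof.
move=> iu iv xE vE yE.
have [d od dE] : exists2 d, odd2 d & 3 * x ^+ 2 - 4 = - d.
  exists (1 - 48 * u1 - 192 * u1 ^+ 2); last by rewrite xE; ring.
  by exists (- 24 * u1 - 96 * u1 ^+ 2); [int2 | ring].
have d0 := odd2_neq0 od; have idV := odd2_int2 (odd2V od).
have [y1 iy {}yE] : exists2 y1, y1 \is a int2 & y = 3 + 8 * y1.
  (* Chosen so that [N / d = (y - 3) / 8]. *)
  pose N := 19 * u1 + 72 * u1 ^+ 2 - 2 * v1.
  exists (N * d^-1); first by rewrite /N; int2.
  have dE' : d = 1 - 48 * u1 - 192 * u1 ^+ 2.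
    by rewrite -[d]opprK -dE xE; ring.
  have nE : 2 * v - x = - (3 * d + 8 * N) by rewrite vE xE dE' /N; ring.
  by rewrite yE dE nE invrN mulrNN mulrDl mulfK // mulrA.
split; first by rewrite dE oppr_eq0.
  exists (1 + 2 * (3 * y1 + 4 * y1 ^+ 2)); last by rewrite yE; ring.
  by exists (3 * y1 + 4 * y1 ^+ 2); [int2 | ].
pose t1 := 1 + 2 * (y1 + 3 * u1 + 8 * u1 * y1).
exists (1 + 2 * (2 * t1 ^+ 2 - 1)).
  by exists (2 * t1 ^+ 2 - 1); [rewrite /t1; int2 | ].
by rewrite xE yE /t1; field.
Qed.

Lemma square_triple_val2 n : exists a b c : rat,
  [/\ square_triple a b c, val2 n.+4 a, val2 3 b & val2 0 c].
Proof.
(* Starting from index [n.+1] makes [e] divisible by 4, hence [k] by 16 and [x - 1] by 8. *)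
have [k [e [E [k' ik kE] ve]]] := curve_val2 n.+1.
have e0 := val2_neq0 ve; case: ve => w ow eE.
have iw := odd2_int2 ow; have k_int : k \is a int2 by rewrite kE; int2.
have [e1 ie1 eE1] : exists2 e1, e1 \is a int2 & e = 4 * e1.
  by exists (2 ^+ n * w); [int2 | rewrite eE !exprS; ring].
have [s [os kE1]] : exists s, odd2 s /\ k = e ^+ 2 * s.
  have oS : odd2 (1 + 18 * k - 3 * k ^+ 2).
    by exists (18 * k' - 6 * k' ^+ 2); [int2 | rewrite kE; ring].
  exists (1 + 18 * k - 3 * k ^+ 2)^-1; split; first exact: odd2V.
  by apply: (canRL (mulfK (odd2_neq0 oS))); rewrite E; ring.
have s_int := odd2_int2 os.
have k0 : k != 0 by rewrite kE1 mulf_neq0 ?expf_neq0 // odd2_neq0.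
have [k2 ik2 kE2] : exists2 k2, k2 \is a int2 & k = 16 * k2.
  by exists (e1 ^+ 2 * s); [int2 | rewrite kE1 eE1; ring].
have oQ : odd2 (1 + 6 * k - 3 * k ^+ 2).
  by exists (6 * k' - 6 * k' ^+ 2); [int2 | rewrite kE; ring].
have Q0 := odd2_neq0 oQ.
(* As [k = e^2 s], the term [3 k (k - 1)] is small next to [e], and [xshift k e] is [2 e] times a
   unit. *)
have [U oU uE] : exists2 U, odd2 U & xshift k e = 2 ^+ n.+3 * U.
  exists (w * ((1 + 3 * e * s * (k - 1)) * (1 + 6 * k - 3 * k ^+ 2)^-1)).
    apply: odd2M => //; apply: odd2M; last exact: odd2V.
    by exists (6 * e1 * s * (k - 1)); [int2 | rewrite eE1; ring].
  rewrite /xshift.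
  have -> : 3 * k * (k - 1) = 3 * e ^+ 2 * s * (k - 1).
    by rewrite {1}kE1; ring.
  transitivity (2 * e * (1 + 3 * e * s * (k - 1)) / (1 + 6 * k - 3 * k ^+ 2)).
    by congr (_ / _); ring.
  by rewrite {1}eE [2 ^+ n.+3]exprS; ring.
have iU := odd2_int2 oU.
pose u1 := 2 ^+ n * U; have iu1 : u1 \is a int2 by rewrite /u1; int2.
have uE1 : xshift k e = 8 * u1 by rewrite uE /u1 !exprS; ring.
have [v1 iv1 vE] : exists2 v1, v1 \is a int2 & vcoord k e = -1 + 8 * v1.
  have iQV := odd2_int2 (odd2V oQ).
  rewrite /vcoord uE1; set Q := 1 + 6 * k - _ in Q0 iQV *.
  set M := (X in _ * X / _).
  (* Here [m = (M - 1) / 8], [q = (Q - 1) / 8] and [r = ((1 + 3 k) M - Q^2) / 8], so [v] is [1 - 2]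
     modulo 8. *)
  pose m := 36 * k2 - 96 * k2 ^+ 2 + 3 * (k - 1) * e1 + 18 * k2 * (k - 1) ^+ 2.
  pose q := 12 * k2 - 96 * k2 ^+ 2.
  pose r := 6 * k2 + m + 48 * k2 * m - 2 * q - 8 * q ^+ 2.
  have rE : (1 + 3 * k) * M = Q ^+ 2 + 8 * r.
    by rewrite /M /Q eE1 /r /m /q kE2; ring.
  exists (- 3 * u1 - 2 * (r * Q^-1 ^+ 2)); first by rewrite /r /m /q; int2.
  rewrite -[2 * _ * M]mulrA rE.
  have -> : 2 * (Q ^+ 2 + 8 * r) / Q ^+ 2 = 2 + 16 * (r * Q^-1 ^+ 2).
    by clearbody r Q; field.
  by clearbody r Q u1; ring.
have [d0 vb vc] := biquadratic_val2 iu1 iv1 (congr1 (+%R 1) uE1) vE erefl.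
set x := 1 + xshift k e in d0 vb vc; set y := (_ / _) in vb vc.
set t := (_ / 2) in vc.
(* With [u = x - 1], [x^2 - 1 = u (u + 2)], and [u + 2] is twice a unit. *)
have va : val2 n.+4 (x ^+ 2 - 1).
  exists (U * (1 + 2 * (2 * u1))).
    by apply: odd2M => //; exists (2 * u1) => //; int2.
  rewrite /x; transitivity (xshift k e * (xshift k e + 2)); first by ring.
  by rewrite {1}uE uE1 [2 ^+ n.+4]exprS; ring.
have [||ab ac bc abc] := @biquadratic_squares _ x y t.
- by rewrite /t mulrC divfK.
- by apply: quartic_biquadratic => //; apply: curve_quartic.
exists (x ^+ 2 - 1), (y ^+ 2 - 1), (t ^+ 2 - 1); split=> //; split.
- by rewrite (val2_neq _ va vb) ?(val2_neq _ va vc) ?(val2_neq _ vb vc).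
- by rewrite (val2_neq0 va) (val2_neq0 vb) (val2_neq0 vc).
- by split; [exists x | exists y | exists t]; rewrite subrK.
- by split; [exists (1 - t) | exists (x * t - y) | exists (y * t - x)].
- by exists (t ^+ 2 - t - 1).
Qed.

Theorem theorem1 :
  infinite_set [set T : {fset rat} |
    exists a b c : rat, T = [fset a; b; c]%fset /\ square_triple a b c].
Proof.
have /choice[f fP] (n : nat) : exists T : {fset rat}, exists a b c : rat,
    [/\ T = [fset a; b; c]%fset, square_triple a b c,
      val2 n.+4 a, val2 3 b & val2 0 c].
  have [a [b [c [abc va vb vc]]]] := square_triple_val2 n.
  by exists [fset a; b; c]%fset, a, b, c.
have f_inj : injective f.
  move=> m n fmn.
  have [a [b [c [fE _ va _ _]]]] := fP m.
  have [a' [b' [c' [fE' _ va' vb' vc']]]] := fP n.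
  have : a \in f n by rewrite -fmn fE !inE eqxx.
  (* The valuation of [a] is at least 4, so [a] can only be [a'], and its valuation recovers the
     index. *)
  rewrite fE' !inE -orbA => /or3P[] /eqP aE; rewrite aE in va.
  - by case: (val2_inj va va').
  - by have := val2_inj va vb'.
  - by have := val2_inj va vc'.
apply: (@sub_infinite_set _ (range f)).
  move=> _ [n _ <-]; have [a [b [c [-> abc _ _ _]]]] := fP n.
  by exists a, b, c.
rewrite (eq_finite_set (inj_card_eq (in2W f_inj))).
exact: infinite_nat.
Qed.
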